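(* The triple $(\mathcal M,\hat{+},\hat{\boxtimes})$ is a hyper ring, where $\mathcal M$ is the set of all real matrices of all sizes, and for $A\in\mathcal M_{m\times n}$, $B\in\mathcal M_{p\times q}$, $s=\mathrm{lcm}(m,p)$, $t=\mathrm{lcm}(n,q)$, $$A\hat{+}B:=(A\otimes E_{s/m\times t/n})+(B\otimes E_{s/p\times t/q}),\qquad A\hat{\boxtimes}B:=(A\otimes E_{s/m\times t/n})\boxtimes(B\otimes E_{s/p\times t/q}).$$
   Context: $\mathcal M_{m\times n}$ is the set of real $m\times n$ matrices ($m,n\ge 1$), $\mathcal M=\bigcup_{m,n\ge1}\mathcal M_{m\times n}$ (disjoint union over sizes), $\otimes$ is the Kronecker product. $E_n:=\frac1{\sqrt n}(1,\dots,1)^{T}\in\mathbb R^n$ and $E_{m\times n}:=E_mE_n^{T}$ (all entries $1/\sqrt{mn}$). The dimension-keeping product $\boxtimes$ of $X\in\mathcal M_{a\times b}$ and $Y\in\mathcal M_{c\times d}$ is $X\boxtimes Y:=(X\otimes E_{r/b}^{T})(Y\otimes E_{r/c})\in\mathcal M_{a\times d}$ with $r=\mathrm{lcm}(b,c)$. Hyper group: Let $(G,* )$ be a semigroup. A subset $\mathbf e\subset G$ is an identity set if (i) $g*e=e*g$ for all $g\in G$, $e\in\mathbf e$; (ii) $\mathbf e=\{e_\lambda:\lambda\in\Lambda\}$ is indexed without repetition by a lattice $(\Lambda,\le)$ and $e_\lambda*e_\mu=e_{\lambda\vee\mu}$; (iii) for each $g\in G$ there is a unique $e_g=e_{\lambda_g}\in\mathbf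 e$ such that for all $\lambda\in\Lambda$: $e_\lambda*g=g$ if and only if $\lambda\le\lambda_g$. A hyper group $(G,*,\mathbf e)$ is a semigroup with an identity set such that for each $g\in G$ there is $g^{-1}\in G$ with $g*g^{-1}=g^{-1}*g=e_g$; it is abelian if $*$ is commutative. Hyper ring: a triple $(R,+,\times)$ such that $(R,+)$ is an abelian hyper group, $(R,\times)$ is a semigroup, and $(a+b)\times c=a\times c+b\times c$, $c\times(a+b)=c\times a+c\times b$ for all $a,b,c\in R$. *)

(* Defs.v *)
From HB Require Import structures.
From mathcomp Require Import all_boot all_order all_algebra.
From mathcomp Require Import classical_sets reals mxtens.

Set Implicit Arguments.
Unset Strict Implicit.
Unset Printing Implicit Defensive.

Import Order.TTheory GRing.Theory Num.Theory.
Local Open Scope ring_scope.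

(* [l] plays the role of lambda_g: it is the index of the element e_g. *)
Definition identity_index (G : Type) (op : G -> G -> G)
    (d : Order.disp_t) (L : latticeType d) (idx : L -> G) (g : G) (l : L) :
    Prop :=
  forall k : L, op (idx k) g = g <-> (k <= l)%O.

(* [e] is an identity set of (G, op), as witnessed by the indexing [idx]. *)
Record indexes_identity_set (G : Type) (op : G -> G -> G) (e : set G)
    (d : Order.disp_t) (L : latticeType d) (idx : L -> G) : Prop :=
  IndexesIdentitySet {
    identity_central : forall g x : G, e x -> op g x = op x g;
    identity_range : range idx = e;
    identity_inj : injective idx;
    identity_join : forall k l : L, op (idx k) (idx l) = idx (Order.join k l);
    identity_unique : forall g : G, exists! x : G,
      e x /\ exists2 l : L, x = idx l & identity_index op idx g l
  }.

(* By [identity_unique] there is only one index [l] as below, so the last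
   clause says that [g] has an inverse with respect to its own e_g. *)
Definition hyper_group (G : Type) (op : G -> G -> G) (e : set G) : Prop :=
  associative op /\
  exists (d : Order.disp_t) (L : latticeType d) (idx : L -> G),
    indexes_identity_set op e idx /\
    forall g : G, exists (g' : G) (l : L),
      [/\ identity_index op idx g l, op g g' = idx l & op g' g = idx l].

Definition abelian_hyper_group (G : Type) (op : G -> G -> G) (e : set G) :
    Prop :=
  hyper_group op e /\ commutative op.

Definition hyper_ring (T : Type) (add mul : T -> T -> T) : Prop :=
  [/\ exists e : set T, abelian_hyper_group add e,
      associative mul,
      left_distributive mul add
    & right_distributive mul add].

Record anymx (R : realType) : Type := AnyMx {
  nrows : nat;
  ncols : nat;
  nrows_gt0 : (0 < nrows)%N;
  ncols_gt0 : (0 < ncols)%N;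
  mxof_anymx : 'M[R]_(nrows, ncols)
}.

Definition Ecol (R : realType) (n : nat) : 'cV[R]_n :=
  const_mx (1 / Num.sqrt n%:R).

Definition Emx (R : realType) (m n : nat) : 'M[R]_(m, n) :=
  Ecol R m *m (Ecol R n)^T.

Lemma muln_div_eq (m s : nat) : (m %| s)%N -> (m * (s %/ m) = s)%N.
Proof. by move=> ms; rewrite mulnC divnK. Qed.

(* A (x) E_{s/m x t/n}, cast from size (m * (s/m)) x (n * (t/n)) to s x t. *)
Definition extmx (R : realType) (m n s t : nat) (ms : (m %| s)%N)
    (nt : (n %| t)%N) (A : 'M[R]_(m, n)) : 'M[R]_(s, t) :=
  castmx (muln_div_eq ms, muln_div_eq nt)
    (A *t Emx R (s %/ m) (t %/ n)).

(* The dimension-keeping product of arbitrary rectangular matrices; the two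
   factors are cast from a*1 x b*(r/b) to a x r and from c*(r/c) x d*1 to
   r x d, where r = lcm(b, c). *)
Definition dkmul (R : realType) (a b c d : nat)
    (X : 'M[R]_(a, b)) (Y : 'M[R]_(c, d)) : 'M[R]_(a, d) :=
  castmx (muln1 a, muln_div_eq (dvdn_lcml b c))
    (X *t (Ecol R (lcmn b c %/ b))^T)
  *m castmx (muln_div_eq (dvdn_lcmr b c), muln1 d)
    (Y *t Ecol R (lcmn b c %/ c)).

Lemma lcmn_pos (m n : nat) : (0 < m)%N -> (0 < n)%N -> (0 < lcmn m n)%N.
Proof. by move=> m0 n0; rewrite lcmn_gt0 m0 n0. Qed.

Definition hat_add (R : realType) (A B : anymx R) : anymx R :=
  AnyMx (lcmn_pos (nrows_gt0 A) (nrows_gt0 B))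
        (lcmn_pos (ncols_gt0 A) (ncols_gt0 B))
    (extmx (dvdn_lcml (nrows A) (nrows B)) (dvdn_lcml (ncols A) (ncols B))
       (mxof_anymx A)
     + extmx (dvdn_lcmr (nrows A) (nrows B)) (dvdn_lcmr (ncols A) (ncols B))
         (mxof_anymx B)).

Definition hat_dkmul (R : realType) (A B : anymx R) : anymx R :=
  AnyMx (lcmn_pos (nrows_gt0 A) (nrows_gt0 B))
        (lcmn_pos (ncols_gt0 A) (ncols_gt0 B))
    (dkmul
       (extmx (dvdn_lcml (nrows A) (nrows B)) (dvdn_lcml (ncols A) (ncols B))
          (mxof_anymx A))
       (extmx (dvdn_lcmr (nrows A) (nrows B)) (dvdn_lcmr (ncols A) (ncols B))
          (mxof_anymx B))).

(* Main.v *)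
Require Import Defs.
From HB Require Import structures.
From mathcomp Require Import all_boot all_order all_algebra.
From mathcomp Require Import classical_sets reals mxtens.

(** An m x n matrix [A] is a step function on the unit square, cut into m x n
    equal boxes, whose value on the box (i, j) is sqrt (m n) A_ij.  With this
    normalization tensoring with E_{s/m x t/n} refines the grid and leaves the
    function unchanged, so [hat_add] is the pointwise sum of the functions on
    the least common refinement of the two grids, and [hat_dkmul] is the
    composition of integral kernels (f g)(x, y) = int f(x, z) g(z, y) dz, on
    the same refinement.  A matrix is thus a grid, given by a pair of positive
    integers, together with a function constant on the boxes of that grid.
    Every law of a hyper ring then splits into a law of lcm for the grids and
    the corresponding law of addition and composition for the functions.

    No integral is needed.  Three matrices live on a common N x N grid, and
    there the step function of [A] becomes the matrix
    [lift N A = U_m^T A U_n], where U_m = [stretch m N] is the isometry that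
    refines vectors from m to N blocks.  The isometries are coherent
    ([mul_stretch]) and satisfy U_m U_m^T = 1 ([stretch_isometry]).  It
    follows that [lift N] is injective on matrices of a given size
    ([anymx_eq]) and that it turns [hat_add] into the sum and [hat_dkmul] into
    the ordinary product of N x N matrices ([lift_add], [lift_dkmul]).

    The identity set consists of the zero matrices, one for each size, indexed
    by pairs of positive integers ordered by divisibility.  Adding the zero
    matrix of size k only refines the grid, and so fixes [A] exactly when k
    divides the size of [A] ([zeromx_index]); this makes the zero matrix of
    the size of [A] the identity attached to [A], and - A the inverse. *)

Set Implicit Arguments.
Unset Strict Implicit.
Unset Printing Implicit Defensive.

Import Order.TTheory GRing.Theory Num.Theory.
Local Open Scope ring_scope.

(** * Refinement of vectors *)

Section Stretch.

Variable R : realType.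

(** If m divides s, this is [1%:M *t (Ecol R (s %/ m))^T], with its size
    m * 1 x m * (s/m) read as m x s.  The entrywise form avoids casts, so that
    stretches compose without transport along equalities of sizes. *)
Definition stretch (m s : nat) : 'M[R]_(m, s) :=
  \matrix_(i, j) (if (j %/ (s %/ m) == i)%N
                  then 1 / Num.sqrt (s %/ m)%:R else 0).

(** The coarse block to which the fine index [j] belongs. *)
Definition block_index (m s : nat) (ms : (m %| s)%N) (j : 'I_s) : 'I_m :=
  (mxtens_unindex (cast_ord (esym (muln_div_eq ms)) j)).1.

Lemma mul_stretchE (a m s : nat) (ms : (m %| s)%N) (X : 'M[R]_(a, m)) k j :
  (X *m stretch m s) k j
  = X k (block_index ms j) * (1 / Num.sqrt (s %/ m)%:R).
Proof.
rewrite mxE (bigD1 (block_index ms j)) //= mxE eqxx big1 ?addr0 // => i.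
by rewrite -val_eqE /= eq_sym => /negbTE ne_i; rewrite mxE ne_i mulr0.
Qed.

Lemma trmul_stretchE (d m s : nat) (ms : (m %| s)%N) (Y : 'M[R]_(m, d)) i k :
  ((stretch m s)^T *m Y) i k
  = Y (block_index ms i) k * (1 / Num.sqrt (s %/ m)%:R).
Proof.
have := mul_stretchE ms Y^T k i.
by rewrite -[_ *m _]trmxK trmx_mul trmxK mxE => ->; rewrite mxE.
Qed.

(** With [tens_EcolE] and [extmxE], this turns the operations on [anymx] into
    plain matrix products, so that their laws can be proved without tensors or
    casts. *)
Lemma tens_ErowE (a m s : nat) (ms : (m %| s)%N) (X : 'M[R]_(a, m)) :
  castmx (muln1 a, muln_div_eq ms) (X *t (Ecol R (s %/ m))^T)
  = X *m stretch m s.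
Proof.
apply/matrixP => k j; rewrite (mul_stretchE ms) castmxE /= !mxE.
by congr (X _ _ * _); apply: val_inj; rewrite /= divn1.
Qed.

Lemma tens_EcolE (d m s : nat) (ms : (m %| s)%N) (Y : 'M[R]_(m, d)) :
  castmx (muln_div_eq ms, muln1 d) (Y *t Ecol R (s %/ m))
  = (stretch m s)^T *m Y.
Proof.
by apply: trmx_inj; rewrite trmx_cast trmx_tens tens_ErowE trmx_mul trmxK.
Qed.

Lemma extmxE (m n s t : nat) (ms : (m %| s)%N) (nt : (n %| t)%N)
    (A : 'M[R]_(m, n)) :
  extmx ms nt A = (stretch m s)^T *m A *m stretch n t.
Proof.
apply/matrixP => i j.
rewrite (mul_stretchE nt) (trmul_stretchE ms) castmxE /= !mxE big_ord1 !mxE.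
by rewrite mulrA.
Qed.

(** Cutting each of m blocks into s/m pieces and each of these into N/s gives
    N/m pieces per block, and the normalizing factors multiply as square
    roots do. *)
Lemma mul_stretch (m s N : nat) :
  (m %| s)%N -> (s %| N)%N -> (0 < s)%N ->
  stretch m s *m stretch s N = stretch m N.
Proof.
move=> ms sN s_gt0; apply/matrixP => i l; rewrite (mul_stretchE sN) !mxE /=.
have -> : (N %/ m = N %/ s * (s %/ m))%N by rewrite muln_divA // divnK.
rewrite -divnMA; case: ifP => _; last by rewrite mul0r.
by rewrite natrM sqrtrM ?ler0n // !div1r invfM mulrC.
Qed.

Lemma castmx_mul_inner (m m' n n' p p' : nat) (em : m = m') (en : n = n')
    (ep : p = p') (A : 'M[R]_(m, n)) (B : 'M[R]_(n, p)) :
  castmx (em, en) A *m castmx (en, ep) B = castmx (em, ep) (A *m B).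
Proof. by case: m' / em; case: n' / en; case: p' / ep. Qed.

(** In tensor form: (1 *t E^T) (1 *t E) = 1 *t (E^T E), and E is a unit
    vector. *)
Lemma stretch_isometry (m s : nat) :
  (m %| s)%N -> (0 < s)%N -> stretch m s *m (stretch m s)^T = 1%:M.
Proof.
move=> ms s_gt0; set d := (s %/ m)%N.
have d_gt0 : (0 < d)%N.
  by move: s_gt0; rewrite -(muln_div_eq ms) muln_gt0 => /andP[].
have unitE : (Ecol R d)^T *m Ecol R d = 1%:M.
  apply/matrixP => i j; rewrite !ord1 !mxE.
  under eq_bigr do rewrite !mxE.
  rewrite sumr_const card_ord -expr2 expr_div_n expr1n sqr_sqrtr ?ler0n //.
  by rewrite div1r -[LHS]mulr_natr mulVf // pnatr_eq0 -lt0n.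
rewrite -[LHS]mul1mx mulmxA -(tens_ErowE ms) -[(stretch m s)^T]mulmx1.
rewrite -(tens_EcolE ms) castmx_mul_inner tensmx_mul unitE mul1mx.
by rewrite tens_mx_scalar scale1r castmx_comp castmx_id.
Qed.

(** The inner grid may be refined from lcm(b, c) to any common multiple N: the
    extra stretch and its transpose meet in the middle and cancel by the
    isometry property.  In terms of step functions, the integral over z may be
    computed on any sufficiently fine grid. *)
Lemma dkmulE (a b c d N : nat) (X : 'M[R]_(a, b)) (Y : 'M[R]_(c, d)) :
  (b %| N)%N -> (c %| N)%N -> (0 < N)%N ->
  dkmul X Y = X *m (stretch b N *m (stretch c N)^T) *m Y.
Proof.
move=> bN cN N_gt0; set r := lcmn b c.
have rN : (r %| N)%N by rewrite dvdn_lcm bN.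
have r_gt0 : (0 < r)%N by apply: dvdn_gt0 rN.
rewrite -(mul_stretch (dvdn_lcml b c) rN r_gt0).
rewrite -(mul_stretch (dvdn_lcmr b c) rN r_gt0) trmx_mul.
rewrite [stretch b r *m _ *m _]mulmxA -(mulmxA (stretch b r)).
rewrite stretch_isometry // mulmx1.
by rewrite /dkmul tens_ErowE tens_EcolE !mulmxA.
Qed.

End Stretch.

(** * Matrices of all sizes on a common grid *)

Section Lift.

Variable R : realType.

Definition mxdvd (A : anymx R) (N : nat) : Prop :=
  (nrows A %| N)%N /\ (ncols A %| N)%N.

(** The matrix of the step function of [A] on the N x N grid, a refinement of
    the grid of [A] when [mxdvd A N]. *)
Definition lift (N : nat) (A : anymx R) : 'M[R]_N :=
  (stretch R (nrows A) N)^T *m mxof_anymx A *m stretch R (ncols A) N.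

(** Since U_m and U_n are isometries, A = U_m (U_m^T A U_n) U_n^T can be
    recovered from its lift and its size.  All identities between matrices of
    varying sizes are proved through this criterion. *)
Lemma anymx_eq (N : nat) (A B : anymx R) :
  (0 < N)%N -> mxdvd A N -> nrows A = nrows B -> ncols A = ncols B ->
  lift N A = lift N B -> A = B.
Proof.
case: A B => [m n m_gt0 n_gt0 A] [p q p_gt0 q_gt0 B] N_gt0 [/= mN nN] mp nq.
case: p / mp p_gt0 B => p_gt0; case: q / nq q_gt0 => q_gt0 B.
rewrite /lift /= => eqAB.
have liftK (C : 'M[R]_(m, n)) :
    stretch R m N *m ((stretch R m N)^T *m C *m stretch R n N)
    *m (stretch R n N)^T = C.
  rewrite !mulmxA stretch_isometry // mul1mx -mulmxA stretch_isometry //.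
  by rewrite mulmx1.
have -> : A = B by rewrite -[A]liftK eqAB liftK.
by congr AnyMx; apply: bool_irrelevance.
Qed.

Lemma common_level (A B C : anymx R) :
  exists N : nat, [/\ (0 < N)%N, mxdvd A N, mxdvd B N & mxdvd C N].
Proof.
pose area (D : anymx R) := (nrows D * ncols D)%N.
have area_dvd D M : (area D %| M)%N -> mxdvd D M.
  move=> dM; split; apply: dvdn_trans dM; first exact: dvdn_mulr.
  exact: dvdn_mull.
exists (area A * area B * area C)%N; split.
- by rewrite !muln_gt0 !nrows_gt0 !ncols_gt0.
- by apply/area_dvd/dvdn_mulr/dvdn_mulr.
- by apply/area_dvd/dvdn_mulr/dvdn_mull.
- by apply/area_dvd/dvdn_mull.
Qed.

Lemma mxdvd_add (N : nat) (A B : anymx R) :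
  mxdvd A N -> mxdvd B N -> mxdvd (hat_add A B) N.
Proof. by move=> [? ?] [? ?]; split; rewrite /= dvdn_lcm; apply/andP. Qed.

Lemma mxdvd_dkmul (N : nat) (A B : anymx R) :
  mxdvd A N -> mxdvd B N -> mxdvd (hat_dkmul A B) N.
Proof. exact: mxdvd_add. Qed.

Lemma lift_extmx (m n s t N : nat) (ms : (m %| s)%N) (nt : (n %| t)%N)
    (A : 'M[R]_(m, n)) :
  (s %| N)%N -> (t %| N)%N -> (0 < N)%N ->
  (stretch R s N)^T *m extmx ms nt A *m stretch R t N
  = (stretch R m N)^T *m A *m stretch R n N.
Proof.
move=> sN tN N_gt0.
have s_gt0 := dvdn_gt0 N_gt0 sN; have t_gt0 := dvdn_gt0 N_gt0 tN.
rewrite extmxE -(mul_stretch R ms sN s_gt0) -(mul_stretch R nt tN t_gt0).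
by rewrite trmx_mul !mulmxA.
Qed.

Lemma lift_add (N : nat) (A B : anymx R) :
  (0 < N)%N -> mxdvd A N -> mxdvd B N ->
  lift N (hat_add A B) = lift N A + lift N B.
Proof.
move=> N_gt0 AN BN; have [sN tN] := mxdvd_add AN BN.
by rewrite {1}/lift /= mulmxDr mulmxDl !lift_extmx.
Qed.

(** Once the inner grid of [dkmul] is refined to N, each factor carries a
    stretch on both sides and is a lift by itself. *)
Lemma lift_dkmul (N : nat) (A B : anymx R) :
  (0 < N)%N -> mxdvd A N -> mxdvd B N ->
  lift N (hat_dkmul A B) = lift N A *m lift N B.
Proof.
move=> N_gt0 AN BN; have [sN tN] := mxdvd_dkmul AN BN.
rewrite {1}/lift /= (dkmulE _ _ tN sN) //.
rewrite {2}/lift -(lift_extmx (dvdn_lcmr (nrows A) (nrows B))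
                    (dvdn_lcmr (ncols A) (ncols B)) _ sN tN N_gt0).
rewrite /lift -(lift_extmx (dvdn_lcml (nrows A) (nrows B))
                    (dvdn_lcml (ncols A) (ncols B)) _ sN tN N_gt0).
by rewrite !mulmxA.
Qed.

(** * Semigroup and distributive laws *)

Lemma hat_addA : associative (@hat_add R).
Proof.
move=> A B C; have [N [N_gt0 AN BN CN]] := common_level A B C.
have BCN := mxdvd_add BN CN; have ABN := mxdvd_add AN BN.
apply: (anymx_eq N_gt0 (mxdvd_add AN BCN)); rewrite /= ?lcmnA //.
by rewrite !lift_add // addrA.
Qed.

Lemma hat_addC : commutative (@hat_add R).
Proof.
move=> A B; have [N [N_gt0 AN BN _]] := common_level A B B.
apply: (anymx_eq N_gt0 (mxdvd_add AN BN)) => /=; try exact: lcmnC.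
by rewrite !lift_add // addrC.
Qed.

Lemma hat_dkmulA : associative (@hat_dkmul R).
Proof.
move=> A B C; have [N [N_gt0 AN BN CN]] := common_level A B C.
have BCN := mxdvd_dkmul BN CN; have ABN := mxdvd_dkmul AN BN.
apply: (anymx_eq N_gt0 (mxdvd_dkmul AN BCN)); rewrite /= ?lcmnA //.
by rewrite !lift_dkmul // mulmxA.
Qed.

(** The lcm distributes over itself because it is idempotent; this makes the
    two sides of a distributive law have the same size. *)
Lemma lcmnDl : left_distributive lcmn lcmn.
Proof. by move=> a b c; rewrite lcmnACA [lcmn c c](lcmn_idPl _). Qed.

Lemma lcmnDr : right_distributive lcmn lcmn.
Proof. by move=> a b c; rewrite lcmnACA [lcmn a a](lcmn_idPl _). Qed.

Lemma hat_dkmulDl : left_distributive (@hat_dkmul R) (@hat_add R).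
Proof.
move=> A B C; have [N [N_gt0 AN BN CN]] := common_level A B C.
have ABN := mxdvd_add AN BN.
have ACN := mxdvd_dkmul AN CN; have BCN := mxdvd_dkmul BN CN.
apply: (anymx_eq N_gt0 (mxdvd_dkmul ABN CN)) => /=; try exact: lcmnDl.
by rewrite lift_dkmul // !lift_add // !lift_dkmul // mulmxDl.
Qed.

Lemma hat_dkmulDr : right_distributive (@hat_dkmul R) (@hat_add R).
Proof.
move=> A B C; have [N [N_gt0 AN BN CN]] := common_level A B C.
have BCN := mxdvd_add BN CN.
have ABN := mxdvd_dkmul AN BN; have ACN := mxdvd_dkmul AN CN.
apply: (anymx_eq N_gt0 (mxdvd_dkmul AN BCN)) => /=; try exact: lcmnDr.
by rewrite lift_dkmul // !lift_add // !lift_dkmul // mulmxDr.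
Qed.

End Lift.

(** * The lattice of matrix sizes *)

(** Zero must be excluded, as there are no matrices of size zero; the lattice
    [natdvd] has it as its top element. *)
Definition posnat : {pred natdvd} := fun n => (0 < (n : nat))%N.

Fact posnat_meet :
  {in posnat &, forall m n : natdvd, Order.meet m n \in posnat}.
Proof.
by move=> m n m_gt0 _; rewrite unfold_in [(_ < _)%N]gcdn_gt0 [(0 < m)%N]m_gt0.
Qed.

Fact posnat_join :
  {in posnat &, forall m n : natdvd, Order.join m n \in posnat}.
Proof. by move=> m n; apply: lcmn_pos. Qed.

HB.instance Definition _ :=
  Order.isLatticeClosed.Build Order.dvd_display natdvd posnat
    posnat_meet posnat_join.

Record posdvd := PosDvd { posdvd_val : natdvd; _ : posdvd_val \in posnat }.

HB.instance Definition _ := [isSub for posdvd_val].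
HB.instance Definition _ := [Choice of posdvd by <:].
HB.instance Definition _ :=
  [SubChoice_isSubLattice of posdvd by <: with Order.dvd_display].

(** * The additive hyper group *)

Section ZeroMatrices.

Variable R : realType.

Definition zeromx (l : posdvd *p posdvd) : anymx R :=
  AnyMx (valP l.1) (valP l.2) 0.

Lemma lift_zeromx (N : nat) (l : posdvd *p posdvd) : lift N (zeromx l) = 0.
Proof. by rewrite /lift mulmx0 mul0mx. Qed.

Definition mxsize (A : anymx R) : posdvd *p posdvd :=
  (@PosDvd (nrows A) (nrows_gt0 A), @PosDvd (ncols A) (ncols_gt0 A)).

Lemma zeromxK : cancel zeromx mxsize.
Proof. by case=> k l; congr pair; apply: val_inj. Qed.

Lemma zeromx_join (k l : posdvd *p posdvd) :
  hat_add (zeromx k) (zeromx l) = zeromx (Order.join k l).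
Proof.
have [N [N_gt0 kN lN _]] := common_level (zeromx k) (zeromx l) (zeromx l).
apply: (anymx_eq N_gt0 (mxdvd_add kN lN)) => //.
by rewrite lift_add // !lift_zeromx addr0.
Qed.

(** If the sum with the zero matrix of size k has the size of [A], then k
    divides that size; conversely, equal sizes are enough because the lift of
    a zero matrix vanishes. *)
Lemma zeromx_index (A : anymx R) :
  identity_index (@hat_add R) zeromx A (mxsize A).
Proof.
move=> k; have -> : (k <= mxsize A)%O
    = (nrows (zeromx k) %| nrows A)%N && (ncols (zeromx k) %| ncols A)%N by [].
split=> [kA | /andP[kr kc]].
  apply/andP; split; apply/lcmn_idPr.
    by have := congr1 (@nrows R) kA.
  by have := congr1 (@ncols R) kA.
have [N [N_gt0 kN AN _]] := common_level (zeromx k) A A.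
apply: (anymx_eq N_gt0 (mxdvd_add kN AN)); try exact/lcmn_idPr.
by rewrite lift_add // lift_zeromx add0r.
Qed.

Definition hat_opp (A : anymx R) : anymx R :=
  AnyMx (nrows_gt0 A) (ncols_gt0 A) (- mxof_anymx A).

Lemma hat_addN (A : anymx R) : hat_add A (hat_opp A) = zeromx (mxsize A).
Proof.
have [N [N_gt0 AN _ _]] := common_level A A A.
have oppAN : mxdvd (hat_opp A) N by [].
apply: (anymx_eq N_gt0 (mxdvd_add AN oppAN)); try exact/lcmn_idPl.
by rewrite lift_add // lift_zeromx /lift /= mulmxN mulNmx subrr.
Qed.

Lemma hat_add_hyper_group : hyper_group (@hat_add R) (range zeromx).
Proof.
split; first exact: hat_addA.
exists _, (posdvd *p posdvd)%type, zeromx; split; last first.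
  move=> A; exists (hat_opp A), (mxsize A).
  by rewrite [hat_add (hat_opp A) A]hat_addC hat_addN; split=> //;
    apply: zeromx_index.
split=> //.
- by move=> A B _; apply: hat_addC.
- exact: can_inj zeromxK.
- exact: zeromx_join.
move=> A; exists (zeromx (mxsize A)); split.
  by split; [exists (mxsize A) | exists (mxsize A) => //; apply: zeromx_index].
(* Two indices with the defining property of lambda_A bound each other. *)
move=> _ [_ [l -> lA]]; congr zeromx; apply/le_anti/andP; split.
  exact/lA/zeromx_index.
exact/zeromx_index/lA.
Qed.

End ZeroMatrices.

Theorem theorem6p3 (R : realType) : hyper_ring (@hat_add R) (@hat_dkmul R).
Proof.
split; [|exact: hat_dkmulA|exact: hat_dkmulDl|exact: hat_dkmulDr].
exists (range (@zeromx R)).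
by split; [exact: hat_add_hyper_group | exact: hat_addC].
Qed.
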